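(* Let $r\ge4$. If $p=p(n) > (\log n)^{-2/(r-2)}$, then with high probability as $n\to\infty$, \[S_r(n,p) \le \exp\bigg(\frac{O\big(n(\log n)^2\big)}{p}\bigg).\]
   Context: $G(n,p)$ is the Erdős–Rényi random graph on $n$ vertices with edge probability $p$. $S_r(n,p)$ is the number of orientations of $G(n,p)$ in which no copy of $K_r$ is strongly connected. $O(\cdot)$ hides a constant depending only on $r$. *)

(* Defs.v *)
From mathcomp Require Import all_boot all_order all_algebra.

Set Implicit Arguments.
Unset Strict Implicit.
Unset Printing Implicit Defensive.

Import GRing.Theory.

(* A simple graph on the vertex set V is given by its edge set, a subset of
   [all_edges V]. *)
Definition all_edges (V : finType) : {set {set V}} :=
  [set e : {set V} | #|e| == 2].

Definition adjacent (V : finType) (G : {set {set V}}) (u v : V) : bool :=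
  [set u; v] \in G.

(* D is the set of arcs: an arc (u, v) is an edge directed from u to v.
   When u = v, [set u; u] is not an edge, so D has no loop. *)
Definition is_orientation (V : finType) (G : {set {set V}})
    (D : {set V * V}) : bool :=
  [forall u, forall v,
     if adjacent G u v then ((u, v) \in D) (+) ((v, u) \in D)
     else (u, v) \notin D].

Definition is_clique (V : finType) (G : {set {set V}}) (X : {set V}) : bool :=
  [forall u in X, forall v in X, (u != v) ==> adjacent G u v].

Definition arc_within (V : finType) (D : {set V * V}) (X : {set V}) : rel V :=
  [rel u v | [&& u \in X, v \in X & (u, v) \in D]].

Definition strongly_connected_on (V : finType) (D : {set V * V})
    (X : {set V}) : bool :=
  [forall u in X, forall v in X, connect (arc_within D X) u v].

Definition no_strong_clique (V : finType) (r : nat) (G : {set {set V}})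
    (D : {set V * V}) : bool :=
  [forall X : {set V},
     (#|X| == r) && is_clique G X ==> ~~ strongly_connected_on D X].

Definition num_orientations (V : finType) (r : nat) (G : {set {set V}}) : nat :=
  #|[set D : {set V * V} | is_orientation G D && no_strong_clique r G D]|.

Local Open Scope ring_scope.

Definition gnp_weight (R : comNzRingType) (n : nat) (p : R)
    (G : {set {set 'I_n}}) : R :=
  \prod_(e in all_edges 'I_n) (if e \in G then p else 1 - p).

(* The probability that G(n,p) satisfies the property A. *)
Definition gnp_prob (R : comNzRingType) (n : nat) (p : R)
    (A : pred {set {set 'I_n}}) : R :=
  \sum_(G in powerset (all_edges 'I_n) | A G) gnp_weight p G.

(* Main.v *)
(* Process the vertices in order. The earlier out-neighbours A of v form a set
   closed under the relation [forces]: u forces w when some (r-1)-clique of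
   earlier neighbours of v has u in its first and w in its last strong component
   (were v -> u and w -> v, the clique and v would span a strong K_r). A closed
   set is generated by an independent set of the relation, and such a set is
   K_(r-1)-free, because the two ends of a clique are related. Recording one
   generating set per vertex determines the orientation, so G has at most N^n
   such orientations, N being the number of K_(r-1)-free vertex sets. By
   Janson's inequality and a union bound, with high probability every set of
   C log n / p vertices of G(n,p) contains a K_(r-1); this is where
   p > (log n)^(-2/(r-2)) is used. Hence N <= n^(C log n / p). *)
Require Import Defs.
From mathcomp Require Import all_boot all_order all_algebra.
From mathcomp Require Import all_classical all_reals all_analysis.
From mathcomp Require Import ring lra.
(* Imported again because MathComp-Analysis shadows some of their names. *)
From mathcomp Require Import fintype finset.
Require Import Defs.

Set Implicit Arguments.
Unset Strict Implicit.
Unset Printing Implicit Defensive.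

Import Order.TTheory GRing.Theory Num.Theory numFieldNormedType.Exports.

(** * Encoding orientations by clique-free sets *)

(** An inclusion-minimal generating set works: if [e u w] held for distinct [u] and [w] in it,
    everything reached from [w] would be reached from [u], and [w] could be dropped. *)
Lemma closed_set_generators (T : finType) (e : rel T) (A : {set T}) :
    (forall u w, u \in A -> e u w -> w \in A) ->
  exists S : {set T},
    [/\ S \subset A, A = [set w | [exists u in S, connect e u w]]
      & {in S &, forall u w, e u w -> u = w}].
Proof.
move=> clA; pose gen (S : {set T}) := [set w | [exists u in S, connect e u w]].
have clA' u w : u \in A -> connect e u w -> w \in A.
  move=> uA /connectP[s es ->]; elim: s u uA es => //= x s IH u uA /andP[ux].
  by apply: IH; apply: clA ux.
have genA : gen A == A.
  apply/eqP/setP => w; rewrite inE; apply/existsP/idP => [[u /andP[uA]]|wA].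
    exact: clA'.
  by exists w; rewrite wA connect0.
have [S minS sSA] := minset_exists (P := fun S => gen S == A) genA.
exists S; split=> //; first by case/minsetP: minS => /eqP <-.
move=> u w uS wS euw; apply/eqP/idPn => neq_uw.
case/minsetP: minS => /eqP genS minS.
suff /minS/(_ (subsetDl _ _)) eqS : gen (S :\ w) == A.
  by move: wS; rewrite -eqS !inE eqxx.
rewrite -genS; apply/eqP/setP => x; rewrite !inE.
apply/existsP/existsP => -[y /andP[yS yx]].
  by exists y; rewrite yx andbT; case/setD1P: yS.
have [eq_yw|neq_yw] := eqVneq y w; last by exists y; rewrite !inE neq_yw yS.
exists u; rewrite !inE neq_uw uS /=.
by apply: connect_trans (connect1 euw) _; rewrite -eq_yw.
Qed.

(** Take a vertex reaching the most elements of [X]: an unreached [x] would satisfy [e x u], hence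
    reach all that [u] reaches and itself besides. *)
Lemma tournament_root (T : finType) (e : rel T) (X : {set T}) :
    X != set0 -> {in X &, forall x y, x != y -> e x y || e y x} ->
  exists2 u, u \in X & {in X, forall x, connect e u x}.
Proof.
case/set0Pn=> x0 x0X tour.
pose F x := #|[set y in X | connect e x y]|.
case: (@arg_maxnP _ x0 (mem X) F x0X) => u uX maxu; exists u => // x xX.
apply/idPn => nux.
have neq_ux : u != x by apply: contraNneq nux => ->.
have exu : e x u.
  have := tour _ _ uX xX neq_ux.
  by case/orP=> // /connect1 cux; rewrite cux in nux.
have : F u < F x.
  apply: proper_card; apply/properP; split; last by exists x; rewrite !inE xX ?connect0.
  apply/subsetP=> y; rewrite !inE => /andP[-> uy] /=.
  exact: connect_trans (connect1 exu) uy.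
by rewrite ltnNge; have -> : F x <= F u by exact: maxu.
Qed.

Lemma tournament_ends (T : finType) (e : rel T) (X : {set T}) :
    1 < #|X| -> {in X &, forall x y, x != y -> e x y || e y x} ->
  exists u w, [/\ u \in X, w \in X, u != w
    & {in X, forall x, connect e u x && connect e x w}].
Proof.
move=> cardX tour.
have X0 : X != set0 by rewrite -card_gt0 ltnW.
have [u uX uP] := tournament_root X0 tour.
have [|w wX wP] := @tournament_root _ (fun x y => e y x) _ X0.
  by move=> x y xX yX nxy; rewrite orbC tour.
have {}wP x : x \in X -> connect e x w.
  by move=> xX; have := wP x xX; rewrite (connect_rev e).
have [eq_uw|neq_uw] := eqVneq u w; last first.
  by exists u, w; split=> // x xX; rewrite uP ?wP.
(* If the two roots coincide, all of [X] is mutually reachable, and any other vertex can serve as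
   the last one. *)
have [w' w'X neq] : exists2 w', w' \in X & u != w'.
  have : 0 < #|X :\ u| by move: cardX; rewrite (cardsD1 u X) uX.
  by case/card_gt0P=> w'; rewrite !inE eq_sym => /andP[? ?]; exists w'.
exists u, w'; split=> // x xX; rewrite uP //=.
by apply: connect_trans (wP x xX) _; rewrite -eq_uw uP.
Qed.

Definition clique_free (V : finType) (k : nat) (G : {set {set V}}) (S : {set V}) :=
  [forall X : {set V}, (X \subset S) && (#|X| == k) ==> ~~ is_clique G X].

Section OrientationCode.

Variables (n r : nat) (G : {set {set 'I_n}}).
Implicit Types (D : {set 'I_n * 'I_n}) (u v w : 'I_n).

Definition earlier_nbrs v : {set 'I_n} := [set u : 'I_n | (u < v) && adjacent G u v].

Definition earlier_outs D v : {set 'I_n} :=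
  [set u in earlier_nbrs v | (v, u) \in D].

(* If [v] beats [u] and [w] beats [v], then [X] together with [v] is strongly
   connected. *)
Definition forces D v : rel 'I_n := fun u w =>
  [exists X : {set 'I_n},
    [&& X \subset earlier_nbrs v, #|X| == r.-1, is_clique G X, u \in X, w \in X
      & [forall x in X, connect (arc_within D X) u x
                        && connect (arc_within D X) x w]]].

Lemma orientation_total D u v : is_orientation G D -> adjacent G u v ->
  ((u, v) \in D) = ((v, u) \notin D).
Proof.
move=> /forallP/(_ u)/forallP/(_ v) H adj; rewrite adj in H.
by move: H; case: (_ \in D) => /=; [move/negbTE=> -> | move=> ->].
Qed.

Lemma adjacentC u v : adjacent G u v = adjacent G v u.
Proof. by rewrite /adjacent setUC. Qed.

Lemma nonadjacent_nonarc D u v :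
  is_orientation G D -> ~~ adjacent G u v -> ((u, v) \in D) = false.
Proof.
move=> /forallP/(_ u)/forallP/(_ v) + /negbTE adj.
by rewrite adj => /negbTE.
Qed.

Lemma earlier_outs_closed D v u w : 0 < r -> is_orientation G D ->
  no_strong_clique r G D -> u \in earlier_outs D v -> forces D v u w ->
  w \in earlier_outs D v.
Proof.
move=> r_gt0 oD noD; rewrite inE => /andP[uN vu].
case/existsP=> X /and5P[XN /eqP cX clX uX /andP[wX /forall_inP Xuw]].
have wN : w \in earlier_nbrs v by apply: (subsetP XN).
rewrite inE wN; apply/idPn => /= nvw.
have adjv x : x \in X -> adjacent G v x.
  by move/(subsetP XN); rewrite inE adjacentC => /andP[].
have wv : (w, v) \in D by rewrite (orientation_total oD) // adjacentC adjv.
have vX : v \notin X.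
  by apply: contraT => /negPn /(subsetP XN); rewrite inE ltnn.
move/forallP/(_ (v |: X)): noD; rewrite cardsU1 vX cX add1n prednK // eqxx /=.
have -> /= : is_clique G (v |: X).
  apply/forall_inP => x /setU1P[->|xX]; apply/forall_inP => y /setU1P[->|yX].
  - by rewrite eqxx.
  - by apply/implyP => _; apply: adjv.
  - by apply/implyP => _; rewrite adjacentC; apply: adjv.
  - by move/forall_inP/(_ x xX)/forall_inP: clX; apply.
have sub x y : connect (arc_within D X) x y -> connect (arc_within D (v |: X)) x y.
  apply: connect_sub => {}x {}y /and3P[xX yX xy]; apply: connect1.
  by rewrite /arc_within /= !inE xX yX xy !orbT.
(* Strong connectivity is checked through [v]: every vertex reaches [v] by way of [w], and [v]
   reaches every vertex by way of [u]. *)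
have toV x : x \in v |: X -> connect (arc_within D (v |: X)) x v.
  case/setU1P=> [->|xX]; first exact: connect0.
  have /andP[_ xw] := Xuw x xX; apply: connect_trans (sub _ _ xw) (connect1 _).
  by rewrite /arc_within /= !inE wX wv eqxx orbT.
have fromV x : x \in v |: X -> connect (arc_within D (v |: X)) v x.
  case/setU1P=> [->|xX]; first exact: connect0.
  have /andP[ux _] := Xuw x xX; apply: connect_trans (connect1 _) (sub _ _ ux).
  by rewrite /arc_within /= !inE uX vu eqxx orbT.
case/negP; apply/forall_inP => x xX; apply/forall_inP => y yX.
exact: connect_trans (toV x xX) (fromV y yX).
Qed.

(** The arcs of [D] on an (r-1)-clique inside [S] form a tournament; its two ends are distinct and
    related by [forces], against the independence of [S]. *)
Lemma forces_free D v (S : {set 'I_n}) : 2 < r -> is_orientation G D ->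
  S \subset earlier_nbrs v -> {in S &, forall u w, forces D v u w -> u = w} ->
  clique_free r.-1 G S.
Proof.
move=> r_gt2 oD SN indS; apply/forallP => X; apply/implyP => /andP[XS /eqP cX].
apply/negP => clX.
have cX1 : 1 < #|X| by rewrite cX -ltnS prednK // ltnW // ltnW.
have [|u [w [uX wX /eqP neq ends]]] := @tournament_ends _ (arc_within D X) _ cX1.
  move=> x y xX yX nxy; rewrite /arc_within /= xX yX /=.
  have adj : adjacent G x y.
    by move/forall_inP/(_ x xX)/forall_inP/(_ y yX)/implyP: clX; apply.
  by rewrite (orientation_total oD adj); case: (_ \in D).
apply: neq; apply: indS; rewrite ?(subsetP XS) //.
apply/existsP; exists X.
by rewrite (subset_trans XS SN) cX eqxx clX uX wX; apply/forall_inP.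
Qed.

Definition is_code D v (S : {set 'I_n}) :=
  [&& clique_free r.-1 G S, S \subset earlier_nbrs v &
      earlier_outs D v == [set w | [exists u in S, connect (forces D v) u w]]].

Lemma is_code_exists D v : 2 < r -> is_orientation G D ->
  no_strong_clique r G D -> exists S, is_code D v S.
Proof.
move=> r_gt2 oD noD.
have r_gt0 : 0 < r by do 2 apply: ltnW.
have [|S [SA genS indS]] :=
    @closed_set_generators _ (forces D v) (earlier_outs D v).
  by move=> u w; apply: earlier_outs_closed.
have SN : S \subset earlier_nbrs v.
  by apply: subset_trans SA _; apply/subsetP => u; rewrite inE => /andP[].
by exists S; rewrite /is_code SN -genS eqxx (forces_free r_gt2 oD SN).
Qed.

(** Induction over the vertex order: [forces D v] looks only at arcs among vertices before [v], so
    once these agree, the same generators [S v] yield the same earlier out-neighbours. *)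
Lemma is_code_inj D1 D2 (S : 'I_n -> {set 'I_n}) :
    is_orientation G D1 -> is_orientation G D2 ->
    (forall v, is_code D1 v (S v)) -> (forall v, is_code D2 v (S v)) ->
  D1 = D2.
Proof.
move=> o1 o2 code1 code2.
have low k u v : u < k -> v < k -> ((u, v) \in D1) = ((u, v) \in D2).
  elim: k u v => // k IH u v.
  have outs v1 : v1 = k :> nat -> earlier_outs D1 v1 = earlier_outs D2 v1.
    move=> def_v; have /and3P[_ _ /eqP ->] := code1 v1.
    have /and3P[_ _ /eqP ->] := code2 v1.
    suff eq_f : forces D1 v1 =2 forces D2 v1.
      apply/setP => w; rewrite !inE; apply: eq_existsb => x.
      by rewrite (eq_connect eq_f).
    move=> x w; apply: eq_existsb => X.
    case XN : (X \subset _) => //=; do 4 congr (_ && _).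
    have eq_arc : arc_within D1 X =2 arc_within D2 X.
      move=> y z; rewrite /arc_within /=.
      case yX : (y \in X) => //=; case zX : (z \in X) => //=.
      by apply: IH; rewrite -def_v;
         have := subsetP XN; [move/(_ _ yX) | move/(_ _ zX)];
         rewrite inE => /andP[].
    by apply: eq_forallb => y; rewrite !(eq_connect eq_arc).
  have outs2 (x y : 'I_n) : x = k :> nat -> y < k -> ((x, y) \in D1) = ((x, y) \in D2).
    move=> def_x ltyk; have := outs x def_x; move/setP/(_ y); rewrite !inE.
    rewrite def_x ltyk /=; rewrite adjacentC.
    have [//|nadj _] := boolP (adjacent G x y).
    by rewrite !nonadjacent_nonarc.
  rewrite !ltnS (leq_eqVlt u) (leq_eqVlt v).
  case/orP=> [/eqP uk|uk] /orP[/eqP vk|vk].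
  - have -> : u = v by apply: val_inj; rewrite /= uk vk.
    (* Here [G] is any family of sets and might contain a singleton; an orientation excludes it,
       since [(v, v) \in D1] would be equivalent to its own negation. *)
    have [adj|nadj] := boolP (adjacent G v v); last by rewrite !nonadjacent_nonarc.
    have := orientation_total o1 adj; by case: (_ \in _).
  - exact: outs2.
  - have [adj|nadj] := boolP (adjacent G u v); last by rewrite !nonadjacent_nonarc.
    by rewrite (orientation_total o1) // (orientation_total o2) // outs2.
  - exact: IH.
by apply/setP => -[u v]; apply: (low n).
Qed.

Lemma num_orientations_le : 2 < r ->
  num_orientations r G <= #|[set S | clique_free r.-1 G S]| ^ n.
Proof.
move=> r_gt2.
(* The default [set0] never occurs for the orientations counted, since each of them has a code at
   every vertex. *)
pose code D : {ffun 'I_n -> {set 'I_n}} :=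
  [ffun v => odflt set0 [pick S | is_code D v S]].
rewrite /num_orientations; set F := [set S | _]; set O := [set D | _].
have codeP D : D \in O -> forall v, is_code D v (code D v).
  rewrite inE => /andP[oD noD] v; rewrite ffunE; case: pickP => //= nocode.
  by have [S] := is_code_exists v r_gt2 oD noD; rewrite nocode.
have -> : #|F| ^ n = #|@ffun_on_mem 'I_n {set 'I_n} (mem F)|.
  by rewrite card_ffun_on card_ord.
rewrite -(@card_in_imset _ _ code).
  apply/subset_leq_card/subsetP => _ /imsetP[D DO ->].
  by apply/ffun_onP => v; rewrite inE; case/and3P: (codeP D DO v).
move=> D1 D2 D1O D2O eq_code; apply: (@is_code_inj _ _ (code D1)).
- by move: D1O; rewrite inE => /andP[].
- by move: D2O; rewrite inE => /andP[].
- exact: codeP.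
- by rewrite eq_code; apply: codeP.
Qed.

End OrientationCode.

(** * Counting small vertex sets *)

Lemma bin_le_exp n k : 'C(n, k) <= n ^ k.
Proof.
elim: k n => [|k IH] n; first by rewrite bin0.
case: n => // n.
rewrite -(leq_pmul2l (ltn0Sn k)) -mul_bin_diag /= expnS mulnCA leq_mul2l /=.
apply: leq_trans (IH n) _.
apply: leq_trans (leq_pmull _ (ltn0Sn k)).
by case: k {IH} => // k; rewrite leq_exp2r.
Qed.

(** Sets of size exactly [m] add at most [n ^ m], and doubling is absorbed by the next factor [n],
    which is at least 2. *)
Lemma card_small_sets n m : 1 < n -> #|[set S : {set 'I_n} | #|S| < m]| <= n ^ m.
Proof.
move=> n_gt1; elim: m => [|m IH].
  by rewrite (_ : [set _ | _] = set0) ?cards0 //; apply/setP => S; rewrite !inE.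
have -> : [set S : {set 'I_n} | #|S| < m.+1] =
   [set S : {set 'I_n} | #|S| < m] :|: [set S : {set 'I_n} | #|S| == m].
  by apply/setP => S; rewrite !inE ltnS leq_eqVlt orbC.
apply: leq_trans (leq_card_setU _ _) _.
rewrite card_draws card_ord expnS.
apply: leq_trans (leq_add IH (bin_le_exp n m)) _.
by rewrite addnn -mul2n leq_mul2r n_gt1 orbT.
Qed.

Local Open Scope ring_scope.

(** * Janson's inequality *)

Section BernoulliExpectation.

Variables (R : realType) (T : finType) (p : R).
Hypothesis p01 : 0 <= p <= 1.
Implicit Types (l : seq T) (f g : {set T} -> R) (A G H : {set T}).

(* The expectation of [f] on the random subset of [l] containing each element
   of [l] independently with probability [p]. *)
Fixpoint bexp l f : R :=
  if l is e :: l' then p * bexp l' (fun G => f (e |: G)) + (1 - p) * bexp l' f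
  else f set0.

Let p_ge0 : 0 <= p. Proof. by case/andP: p01. Qed.
Let q_ge0 : 0 <= 1 - p. Proof. by rewrite subr_ge0; case/andP: p01. Qed.

Lemma bexp_le l f g :
  (forall G, G \subset l -> f G <= g G) -> bexp l f <= bexp l g.
Proof.
elim: l f g => [|e l IH] f g le_fg /=.
  by apply: le_fg; apply/subsetP => x; rewrite inE.
rewrite lerD // ler_wpM2l //; apply: IH => G /subsetP Gl; apply: le_fg.
  by apply/subsetP => x /setU1P[->|/Gl]; rewrite inE ?eqxx // => ->; rewrite orbT.
by apply/subsetP => x /Gl; rewrite inE => ->; rewrite orbT.
Qed.

Lemma eq_bexp l f g :
  (forall G, G \subset l -> f G = g G) -> bexp l f = bexp l g.
Proof.
by move=> eq_fg; apply/eqP; rewrite eq_le !bexp_le // => G /eq_fg ->.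
Qed.

Lemma bexp_cst l c : bexp l (fun=> c) = c.
Proof. by elim: l => //= e l ->; ring. Qed.

Lemma bexpZ l c f : bexp l (fun G => c * f G) = c * bexp l f.
Proof. by elim: l f => //= e l IH f; rewrite !IH; ring. Qed.

Lemma bexpB l f g : bexp l (fun G => f G - g G) = bexp l f - bexp l g.
Proof. by elim: l f g => //= e l IH f g; rewrite !IH; ring. Qed.

Lemma bexp_sum (I : Type) (s : seq I) (P : pred I) l (F : I -> {set T} -> R) :
  bexp l (fun G => \sum_(i <- s | P i) F i G) = \sum_(i <- s | P i) bexp l (F i).
Proof. by elim: l F => //= e l IH F; rewrite !IH !big_distrr -big_split. Qed.

(** A weighted average of two values is at most the larger one. This first-moment principle selects
    a subfamily of indices in [janson]. *)
Lemma bexp_exists_le l f : exists G, bexp l f <= f G.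
Proof.
elim: l f => [|e l IH] f /=; first by exists set0.
have [G1 le1] := IH (fun G => f (e |: G)); have [G2 le2] := IH f.
have {le1}le1 := ler_wpM2l p_ge0 le1; have {le2}le2 := ler_wpM2l q_ge0 le2.
have [le12|lt12] := leP (f (e |: G1)) (f G2).
  by exists G2; have := ler_wpM2l p_ge0 le12; lra.
by exists (e |: G1); have := ler_wpM2l q_ge0 (ltW lt12); lra.
Qed.

(** Harris' inequality, conditioning on one element at a time: each step gains [p * (1 - p)] times
    the product of the mean rise of [f] and the mean drop of [g] caused by [e]. *)
Lemma bexp_harris l f g :
    (forall G H, G \subset H -> f G <= f H) ->
    (forall G H, G \subset H -> g H <= g G) ->
  bexp l (fun G => f G * g G) <= bexp l f * bexp l g.
Proof.
elim: l f g => //= e l IH f g incf decg.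
have step G H : G \subset H -> e |: G \subset e |: H by apply: setUS.
have H1 := IH (fun G => f (e |: G)) (fun G => g (e |: G))
  (fun G H sGH => incf _ _ (step G H sGH)) (fun G H sGH => decg _ _ (step G H sGH)).
have H0 := IH f g incf decg.
have lef : bexp l f <= bexp l (fun G => f (e |: G)).
  by apply: bexp_le => G _; apply/incf/subsetUr.
have leg : bexp l (fun G => g (e |: G)) <= bexp l g.
  by apply: bexp_le => G _; apply/decg/subsetUr.
apply: le_trans (lerD (ler_wpM2l p_ge0 H1) (ler_wpM2l q_ge0 H0)) _.
rewrite -subr_ge0; set f1 := bexp l (fun G => f (e |: G)) in lef *.
set g1 := bexp l (fun G => g (e |: G)) in leg *.
rewrite [X in 0 <= X](_ : _ =
    (p * (1 - p)) * ((f1 - bexp l f) * (bexp l g - g1))); last by ring.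
by rewrite !mulr_ge0 // subr_ge0.
Qed.

(** The event [A \subset G] and the value of [g] depend on disjoint sets of coordinates, so they are
    independent. *)
Lemma bexp_indep l A g : uniq l -> A \subset l ->
    (forall e G, e \in A -> g (e |: G) = g G) ->
  bexp l (fun G => (A \subset G)%:R * g G) = p ^+ #|A| * bexp l g.
Proof.
elim: l A g => [|e l IH] A g /=.
  move=> _ /subsetP A0 _; suff -> : A = set0 by rewrite sub0set cards0 mul1r.
  by apply/setP => x; rewrite inE; apply/negP => /A0.
case/andP=> el ul /subsetP Al gA; have [eA|neA] := boolP (e \in A).
  have -> : bexp l (fun G => (A \subset e |: G)%:R * g (e |: G)) =
            bexp l (fun G => (A :\ e \subset G)%:R * g G).
    by apply: eq_bexp => G _; rewrite gA // subDset.
  have -> : bexp l (fun G => g (e |: G)) = bexp l g.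
    by apply: eq_bexp => G _; rewrite gA.
  (* When [e] is left out, [A] cannot be contained in [G]; [uniq] rules out a second occurrence of
     [e] in the list. *)
  have -> : bexp l (fun G => (A \subset G)%:R * g G) = 0.
    rewrite -[RHS](bexp_cst l); apply: eq_bexp => G /subsetP Gl.
    suff /negbTE -> : ~~ (A \subset G) by rewrite mul0r.
    by apply: contra el => /subsetP/(_ e eA)/Gl.
  rewrite IH //; first by rewrite (cardsD1 e A) eA exprS; ring.
    apply/subsetP => x; rewrite !inE => /andP[nxe /Al].
    by rewrite inE (negbTE nxe).
  by move=> x G /setD1P[_ xA]; rewrite gA.
have Al' : A \subset l.
  apply/subsetP => x xA; have := Al x xA; rewrite inE => /orP[/eqP xe|//].
  by rewrite xe (negbTE neA) in xA.
have -> : bexp l (fun G => (A \subset e |: G)%:R * g (e |: G)) =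
          bexp l (fun G => (A \subset G)%:R * g (e |: G)).
  by apply: eq_bexp => G _; rewrite -subDset (setDidPl _) // disjoint_sym disjoints1.
rewrite !IH //; first by ring.
by move=> x G xA; rewrite setUCA gA.
Qed.

Lemma bexp_subset l A : uniq l -> A \subset l ->
  bexp l (fun G => (A \subset G)%:R) = p ^+ #|A|.
Proof.
move=> ul Al; rewrite -[RHS]mulr1 -[X in _ * X](bexp_cst l) -bexp_indep //.
by apply: eq_bexp => G _; rewrite mulr1.
Qed.

(** Ties the recursive expectation to the weighted sum defining [gnp_prob]: subsets are split
    according to whether they contain [e]. *)
Lemma bexpE l f : uniq l ->
  bexp l f = \sum_(G in powerset [set x in l])
     (\prod_(e in [set x in l]) (if e \in G then p else 1 - p)) * f G.
Proof.
elim: l f => [|e l IH] f /=.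
  move=> _; rewrite [X in powerset X](_ : _ = set0); last first.
    by apply/setP => x; rewrite !inE.
  rewrite powerset0 big_set1 big1 ?mul1r // => x.
  by rewrite inE.
case/andP=> el ul; rewrite !IH //; set S := [set x in l].
have eS : e \notin S by rewrite inE.
rewrite set_cons -/S [RHS](bigID (fun G => e \in G)) /=; congr (_ + _).
  rewrite [RHS](reindex_onto (fun G => e |: G) (fun G => G :\ e)) /=; last first.
    by move=> G /andP[_ eG]; apply: setD1K.
  rewrite big_distrr /=; apply: eq_big => G.
    rewrite !powersetE setU11 andbT; apply/idP/andP => [GS|[GS /eqP <-]].
      by rewrite setUS ?setU1K //; apply: contra eS => /(subsetP GS).
    by rewrite subDset.
  rewrite powersetE => GS; rewrite big_setU1 //= setU11 mulrA.
  congr (_ * _ * _); apply: eq_bigr => x xS; rewrite !inE.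
  by have [eq_xe|//] := eqVneq x e; rewrite -eq_xe xS in eS.
rewrite big_distrr /=; apply: eq_big => G.
  rewrite !powersetE; apply/idP/andP => [GS|[GS eG]].
    split; first by rewrite (subset_trans GS) ?subsetUr.
    by apply: contra eS => /(subsetP GS).
  by rewrite -subDset (setDidPl _) // in GS; rewrite disjoint_sym disjoints1.
rewrite powersetE => GS; rewrite big_setU1 //= mulrA.
by rewrite (negbTE (contra (subsetP GS e) eS)).
Qed.

Section Janson.

Variables (I : finType) (A : I -> {set T}).
Implicit Types (s : seq I) (i j : I).

Definition avoids s G := all (fun i => ~~ (A i \subset G)) s.

(** The joint probability of two dependent containment events; summed over pairs, it is the
    correlation term of Janson's inequality. *)
Definition overlap i j : R :=
  if [disjoint A i & A j] then 0 else p ^+ #|A i :|: A j|.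

Lemma overlap_ge0 i j : 0 <= overlap i j.
Proof. by rewrite /overlap; case: ifP => // _; rewrite exprn_ge0. Qed.

Lemma avoids_decr s G H : G \subset H -> (avoids s H)%:R <= (avoids s G)%:R :> R.
Proof.
move=> GH; rewrite ler_nat; case avH : (avoids s H) => //.
suff -> : avoids s G by [].
apply/allP => i /(allP avH); apply: contra => AG; exact: subset_trans AG GH.
Qed.

Lemma subset_incr (B G H : {set T}) :
  G \subset H -> (B \subset G)%:R <= (B \subset H)%:R :> R.
Proof.
move=> GH; rewrite ler_nat; case BG : (B \subset G) => //.
by rewrite (subset_trans BG GH).
Qed.

(* Boppana and Spencer: only the sets of [s] meeting [A i] correlate with it, and
   Harris' inequality bounds the effect of each of them by [overlap]. *)
Lemma bexp_avoids_cons l i s : uniq l -> (forall j, A j \subset l) ->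
  bexp l (fun G => (avoids (i :: s) G)%:R) <=
  bexp l (fun G => (avoids s G)%:R) *
    expR (- (p ^+ #|A i| - \sum_(j <- s) overlap i j)).
Proof.
move=> ul Al; set x := _ - _.
pose far := [seq j <- s | [disjoint A i & A j]].
have avs_far G : avoids s G -> avoids far G.
  by move=> /allP av; apply/allP => j; rewrite mem_filter => /andP[_ /av].
have le_far : bexp l (fun G => (avoids s G)%:R) <= bexp l (fun G => (avoids far G)%:R).
  by apply: bexp_le => G _; rewrite ler_nat; case: (boolP (avoids s G)) => // /avs_far ->.
have av_ge0 s' : 0 <= bexp l (fun G => (avoids s' G)%:R).
  by rewrite -(bexp_cst l 0); apply: bexp_le => G _; rewrite ler0n.
(* For negative [x] the exponential factor exceeds 1. For the rest, [x >= 0] is what allows [far] to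
   be replaced by [s] in the product with [x]. *)
have [x_lt0|x_ge0] := ltP x 0.
  apply: le_trans (_ : bexp l (fun G => (avoids s G)%:R) <= _).
    apply: bexp_le => G _; rewrite ler_nat /=.
    by case: (avoids s G); rewrite ?andbF // leq_b1.
  by apply: ler_peMr => //; rewrite -expR0 ler_expR oppr_ge0 ltW.
suff : bexp l (fun G => (avoids (i :: s) G)%:R) <=
       bexp l (fun G => (avoids s G)%:R) - bexp l (fun G => (avoids far G)%:R) * x.
  move=> /le_trans; apply.
  apply: le_trans (_ : bexp l (fun G => (avoids s G)%:R) * (1 - x) <= _).
    by rewrite [leRHS]mulrBr mulr1 lerD2l lerN2 ler_wpM2r.
  by rewrite ler_wpM2l // expR_ge1Dx.
(* A pointwise bound: if [G] contains [A i] and avoids [far] but not all of [s], then some [A j]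
   meeting [A i] lies in [G] and its term compensates. *)
apply: le_trans (_ : bexp l (fun G => (avoids s G)%:R
    - ((A i \subset G)%:R * (avoids far G)%:R
       - \sum_(j <- s | ~~ [disjoint A i & A j])
           (A i :|: A j \subset G)%:R * (avoids far G)%:R)) <= _).
  apply: bexp_le => G _ /=.
  have sum_ge0 : 0 <= \sum_(j <- s | ~~ [disjoint A i & A j])
           (A i :|: A j \subset G)%:R * (avoids far G)%:R :> R.
    by apply: sumr_ge0 => j _; rewrite mulr_ge0 ?ler0n.
  have [AG|nAG] /= := boolP (A i \subset G); last first.
    by rewrite mul0r sub0r opprK lerDl.
  rewrite mul1r; have [avG|navG] := boolP (avoids s G).
    rewrite avs_far // opprB addrCA subrr addr0.
    by apply: sumr_ge0 => j _; rewrite mulr_ge0 ?ler0n.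
  have [avfar|nfar] := boolP (avoids far G); last first.
    rewrite sub0r opprB subr0.
    by apply: sumr_ge0 => j _; rewrite mulr_ge0 ?ler0n.
  move/allPn: navG => [j js /negPn AjG].
  have ndis : ~~ [disjoint A i & A j].
    apply/negP => dis; move/allP/(_ j): avfar.
    by rewrite mem_filter dis js AjG => /(_ isT).
  rewrite sub0r opprB subr_ge0 (big_rem j) //= ndis subUset AG AjG mulr1 lerDl.
  by apply: sumr_ge0 => k _; rewrite mulr1 ler0n.
(* The sets of [far] are disjoint from [A i], so the main term factors exactly; Harris' inequality
   is left for the correlated terms. *)
rewrite !bexpB bexp_sum lerD2l lerN2 (bexp_indep ul (Al i)); last first.
  move=> e G eA; congr (_%:R); congr nat_of_bool; apply: eq_in_all => j.
  rewrite mem_filter => /andP[dis _]; congr (~~ _).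
  rewrite -subDset (setDidPl _) // disjoint_sym disjoints1.
  by rewrite (disjointFr dis eA).
rewrite /x mulrBr mulrC lerD2l lerN2 big_distrr /=.
rewrite [leRHS](bigID (fun j => [disjoint A i & A j])) /=.
rewrite [X in _ <= X + _]big1 ?add0r; last first.
  by move=> j dis; rewrite /overlap dis mulr0.
apply: ler_sum => j /negbTE dis; rewrite /overlap dis mulrC.
rewrite -(bexp_subset ul); last first.
  by apply/subsetP => y /setUP[/(subsetP (Al i))|/(subsetP (Al j))].
by apply: bexp_harris => G H GH; [apply: subset_incr | apply: avoids_decr].
Qed.

(** Iterates [bexp_avoids_cons]. The iteration meets each unordered pair once, while the double sum
    counts it in both orders, which only weakens the bound. *)
Lemma bexp_avoids_le l s : uniq l -> uniq s -> (forall j, A j \subset l) ->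
  bexp l (fun G => (avoids s G)%:R) <=
  expR (- (\sum_(i <- s) p ^+ #|A i|
           - \sum_(i <- s) \sum_(j <- s | j != i) overlap i j)).
Proof.
move=> ul + Al; elim: s => [|i s IH].
  by rewrite !big_nil subr0 oppr0 expR0 bexp_cst.
move=> /= /andP[iNs us]; apply: le_trans (bexp_avoids_cons i s ul Al) _.
apply: le_trans (ler_wpM2r (expR_ge0 _) (IH us)) _.
rewrite -expRD ler_expR -opprD lerN2 !big_cons eqxx /=.
have -> : \sum_(j <- s | j != i) overlap i j = \sum_(j <- s) overlap i j.
  rewrite big_seq_cond [RHS]big_seq; apply: eq_bigl => j.
  by have [->|] := eqVneq j i; rewrite ?(negbTE iNs) ?andbF ?andbT.
suff : \sum_(i0 <- s) \sum_(j <- s | j != i0) overlap i0 j <=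
  \sum_(i0 <- s) \sum_(j <- i :: s | j != i0) overlap i0 j by lra.
apply: ler_sum => k _; rewrite big_cons; case: ifP => // _.
by rewrite lerDr overlap_ge0.
Qed.

End Janson.

End BernoulliExpectation.

(** The extended form of the inequality: [lam] can be as large as the squared mean divided by the
    full correlation sum, diagonal included. *)
Lemma janson (R : realType) (T I : finType) (p lam : R) (A : I -> {set T})
    (F : {set I}) (l : seq T) :
    0 <= p <= 1 -> uniq l -> (forall i, A i \subset l) ->
    {in F, forall i, A i != set0} -> 0 < lam -> 0 < \sum_(i in F) p ^+ #|A i| ->
    (\sum_(i in F) \sum_(j in F) overlap p A i j) * lam <=
      (\sum_(i in F) p ^+ #|A i|) ^+ 2 ->
  bexp p l (fun G => (avoids A (enum F) G)%:R) <= expR (- (lam / 4)).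
Proof.
move=> p01 ul Al An0 lam_gt0; set mu := \sum_(i in F) p ^+ #|A i| => mu_gt0 Dle.
have ov_ge0 := overlap_ge0 p01 A.
have diag : {in F, forall i, overlap p A i i = p ^+ #|A i|}.
  by move=> i iF; rewrite /overlap -setI_eq0 setIid setUid (negbTE (An0 i iF)).
pose off := \sum_(i in F) \sum_(j in F | j != i) overlap p A i j.
have Doff : \sum_(i in F) \sum_(j in F) overlap p A i j = mu + off.
  rewrite -big_split; apply: eq_bigr => i iF /=.
  by rewrite (bigD1 i) //= diag.
have off_ge0 : 0 <= off by apply: sumr_ge0 => i _; apply: sumr_ge0.
rewrite Doff in Dle.
(* The diagonal alone gives this bound, which keeps the probability [q] below at most 1. *)
have lam_le_mu : lam <= mu.
  rewrite -(ler_pM2l mu_gt0) -expr2; apply: le_trans Dle.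
  by rewrite mulrDl lerDl mulr_ge0 // ltW.
(* Apply [bexp_avoids_le] to a subfamily that does at least as well as the
   average one when the indices are kept independently with probability [q]. *)
pose q := lam / (2 * mu).
have q01 : 0 <= q <= 1.
  rewrite divr_ge0 ?mulr_ge0 ?(ltW lam_gt0) ?(ltW mu_gt0) //=.
  by rewrite ler_pdivrMr ?mulr_gt0 //; lra.
have [S] := bexp_exists_le q01 (enum F) (fun S : {set I} =>
  \sum_(i in F) p ^+ #|A i| * ([set i] \subset S)%:R -
  \sum_(i in F) \sum_(j in F | j != i) overlap p A i j * ([set i; j] \subset S)%:R).
rewrite bexpB !bexp_sum.
have -> : \sum_(i in F) bexp q (enum F)
    (fun G => p ^+ #|A i| * ([set i] \subset G)%:R) = mu * q.
  rewrite big_distrl; apply: eq_bigr => i iF /=.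
  rewrite bexpZ bexp_subset ?cards1 ?enum_uniq //.
  by apply/subsetP => x /set1P ->; rewrite mem_enum.
have -> : \sum_(i in F) bexp q (enum F) (fun G => \sum_(j in F | j != i)
    overlap p A i j * ([set i; j] \subset G)%:R) = off * q ^+ 2.
  rewrite big_distrl; apply: eq_bigr => i iF /=.
  rewrite bexp_sum big_distrl; apply: eq_bigr => j /andP[jF ji] /=.
  rewrite bexpZ bexp_subset ?cards2 ?enum_uniq 1?eq_sym ?ji //.
  by apply/subsetP => x /set2P[] ->; rewrite mem_enum.
(* The value of [q] maximizes [mu * q - off * q ^+ 2] with [off] replaced by its upper bound
   [mu ^+ 2 / lam]; the maximum is [lam / 4]. *)
move=> leS; have leS' : lam / 4 <= mu * q - off * q ^+ 2.
  have -> : mu * q = lam / 2 by rewrite /q; field; rewrite gt_eqF.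
  have : off * q ^+ 2 <= lam / 4.
    have -> : off * q ^+ 2 = (off * lam) * (lam / (4 * mu ^+ 2)).
      by rewrite /q; field; rewrite gt_eqF.
    have -> : lam / 4 = mu ^+ 2 * (lam / (4 * mu ^+ 2)).
      by field; rewrite gt_eqF.
    rewrite ler_wpM2r ?divr_ge0 ?mulr_ge0 ?exprn_ge0 ?(ltW mu_gt0) ?(ltW lam_gt0) //.
    by apply: le_trans Dle; rewrite mulrDl lerDr mulr_ge0 // ltW.
  by lra.
have {leS}leS' := le_trans leS' leS.
apply: le_trans (_ : bexp p l (fun G => (avoids A (enum (F :&: S)) G)%:R) <= _).
  apply: bexp_le => // G _; rewrite ler_nat.
  have [avF|//] := boolP (avoids A (enum F) G); rewrite lt0b.
  apply/allP => i; rewrite mem_enum inE => /andP[iF _].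
  by apply: (allP avF); rewrite mem_enum.
apply: le_trans (bexp_avoids_le p01 ul (enum_uniq _) Al) _.
rewrite ler_expR lerN2; apply: le_trans leS' _.
rewrite !big_enum lerB //.
  rewrite big_mkcond [leRHS]big_mkcond ler_sum // => i _.
  by rewrite inE sub1set; case: (i \in F); case: (i \in S); rewrite ?mulr1 ?mulr0.
rewrite big_mkcond [leRHS]big_mkcond ler_sum // => i _.
rewrite inE; case iF: (i \in F) => //=; case iS : (i \in S) => /=; last first.
  by apply: sumr_ge0 => j _; rewrite mulr_ge0.
rewrite big_enum_cond big_mkcond [leRHS]big_mkcond ler_sum // => j _ /=.
rewrite inE; case: (j \in F) => //=; case: (j != i); rewrite ?andbF ?andbT //.
by rewrite subUset !sub1set iS; case: (j \in S); rewrite ?mulr1 ?mulr0.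
Qed.

(** The quotient of the binomials is a product of factors [(s - i) / (m - i)] for [i < k], each at
    most [s / m]. It bounds the share of s-sets containing a given k-set. *)
Lemma bin_sub_le m s k : (k <= s <= m)%N ->
  ('C(m - k, s - k) * m ^ k <= 'C(m, s) * s ^ k)%N.
Proof.
elim: k => [|k IH] /andP[ks sm]; first by rewrite !subn0.
have {}IH := IH (introT andP (conj (ltnW ks) sm)).
have km : (k < m)%N by apply: leq_trans ks sm.
rewrite -(@leq_pmul2l (m - k)) ?subn_gt0 //.
have := mul_bin_diag (m - k) (s - k.+1).
rewrite -subnS -subSn // subSS => eqC.
rewrite mulnA eqC.
apply: leq_trans (_ : (s - k) * m * ('C(m, s) * s ^ k) <= _)%N.
  by rewrite expnS -!mulnA leq_mul2l mulnCA leq_mul2l IH !orbT.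
have -> : ((m - k) * ('C(m, s) * s ^ k.+1) = s * (m - k) * ('C(m, s) * s ^ k))%N.
  by rewrite expnS; ring.
rewrite leq_mul2r; apply/orP; right.
by rewrite mulnBl mulnBr leq_sub2l // mulnC leq_mul2l sm orbT.
Qed.

(** * Clique-free sets in the random graph *)

Section CliqueFree.

Variables (R : realType) (V : finType) (p : R).
Hypothesis p01 : 0 < p <= 1.
Implicit Types (X Y K U : {set V}).

(** The edge set of the complete graph on [X]; it turns the presence of a clique into a containment
    event, the form that [janson] handles. *)
Definition pairs X : {set {set V}} := [set e : {set V} | e \subset X & #|e| == 2].

Lemma card_pairs X : #|pairs X| = 'C(#|X|, 2).
Proof. exact: cards_draws. Qed.

Lemma pairsI X Y : pairs X :&: pairs Y = pairs (X :&: Y).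
Proof.
by apply/setP => e; rewrite !inE subsetI; case: (_ == 2); rewrite ?andbT ?andbF.
Qed.

Lemma pairs_clique (G : {set {set V}}) X : pairs X \subset G -> is_clique G X.
Proof.
move=> /subsetP XG; apply/forall_inP => u uX; apply/forall_inP => v vX.
apply/implyP => nuv; apply: XG.
by rewrite inE subUset !sub1set uX vX cards2 nuv.
Qed.

Lemma pairs_sub X : pairs X \subset enum (all_edges V).
Proof. by apply/subsetP => e; rewrite mem_enum !inE => /andP[]. Qed.

Lemma card_supersets K U s : K \subset U ->
  (#|[set Y : {set V} | Y \subset U & #|Y| == s] :&: [set Y : {set V} | K \subset Y]|
    <= 'C(#|U| - #|K|, s - #|K|))%N.
Proof.
move=> KU; have <- : #|U :\: K| = (#|U| - #|K|)%N.
  by rewrite cardsD (setIidPr KU).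
rewrite -cards_draws.
rewrite -(@card_in_imset _ _ (fun Y => Y :\: K)).
  apply/subset_leq_card/subsetP => _ /imsetP[Y /setIP[]] + + ->.
  rewrite !inE => /andP[YU /eqP <-] KY.
  by rewrite setSD //= cardsD (setIidPr KY).
move=> Y Z; rewrite !inE => /andP[_ KY] /andP[_ KZ] eqD.
by rewrite -(setID Y K) -(setID Z K) (setIidPr KY) (setIidPr KZ) eqD.
Qed.

(** Janson's inequality for the edge sets of the s-subsets of [U]. The overlaps are grouped by the
    common part [K] of two such subsets; by the density hypothesis each of the at most [2 ^+ s]
    choices of [K] takes at most an equal share of the allowed total. *)
Lemma clique_free_prob U s (lam : R) : (2 <= s <= #|U|)%N -> 0 < lam ->
    (forall k, (2 <= k <= s)%N ->
       2 ^+ s * lam * s%:R ^+ k <= #|U|%:R ^+ k * p ^+ 'C(k, 2)) ->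
  bexp p (enum (all_edges V)) (fun G => (clique_free s G U)%:R) <= expR (- (lam / 4)).
Proof.
move=> /andP[s2 sm] lam_gt0 dense; set m := #|U| in sm dense *.
have [p_gt0 p_le1] := andP p01.
have p01' : 0 <= p <= 1 by rewrite ltW.
pose F := [set X : {set V} | X \subset U & #|X| == s].
have FP X : X \in F -> X \subset U /\ #|X| = s by rewrite inE => /andP[? /eqP].
pose b := 'C(s, 2).
have Fp X : X \in F -> p ^+ #|pairs X| = p ^+ b.
  by move=> /FP[_ cX]; rewrite card_pairs cX.
apply: le_trans (_ : bexp p (enum (all_edges V))
                       (fun G => (avoids pairs (enum F) G)%:R) <= _).
  apply: bexp_le => // G _; rewrite ler_nat.
  have [cf|//] := boolP (clique_free s G U); rewrite lt0b.
  apply/allP => X; rewrite mem_enum inE => XF.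
  by apply: contra (implyP (forallP cf X) XF); apply: pairs_clique.
have mu_eq : \sum_(X in F) p ^+ #|pairs X| = 'C(m, s)%:R * p ^+ b.
  rewrite (eq_bigr (fun=> p ^+ b)); last by move=> X; apply: Fp.
  by rewrite sumr_const cards_draws mulr_natl.
have C_gt0 : 0 < 'C(m, s)%:R :> R by rewrite ltr0n bin_gt0.
have s_gt0 : (0 < s)%N by apply: leq_trans s2.
apply: janson => //.
- exact: enum_uniq.
- exact: pairs_sub.
- by move=> X /FP[_ cX]; rewrite -card_gt0 card_pairs bin_gt0 cX.
- by rewrite mu_eq mulr_gt0 // exprn_gt0.
rewrite mu_eq mulrC big_distrr /=.
(* The squared mean is divided equally among the members of [F], so that one [X] can be fixed. *)
apply: le_trans (_ : \sum_(X in F) 'C(m, s)%:R * p ^+ (b + b) <= _); last first.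
  rewrite sumr_const cards_draws -/m -mulr_natl exprD.
  by rewrite le_eqVlt; apply/orP; left; apply/eqP; ring.
apply: ler_sum => X XF; have [XU cX] := FP X XF.
(* The probability that two s-sets meeting in [k] vertices both span cliques: they share ['C(k, 2)]
   edges. *)
pose w k := p ^+ (b + b) / p ^+ 'C(k, 2).
have w_ge0 k : 0 <= w k by rewrite divr_ge0 ?exprn_ge0 // ltW.
(* The bound sums over all possible values [K] of [X :&: Y]. *)
have overlap_le Y : Y \in F -> overlap p pairs X Y <=
    \sum_(K in powerset X | (1 < #|K|)%N) w #|K| * (K \subset Y)%:R.
  move=> YF; have [_ cY] := FP Y YF; rewrite /overlap.
  have term_ge0 K : 0 <= w #|K| * (K \subset Y)%:R by rewrite mulr_ge0 ?ler0n.
  have [dis|] := ifPn; first exact: sumr_ge0.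
  rewrite -setI_eq0 pairsI -card_gt0 card_pairs bin_gt0 => k2.
  rewrite (bigD1 (X :&: Y)) /=; last by rewrite powersetE subsetIl.
  rewrite subsetIr mulr1 ler_wpDr //; first exact: sumr_ge0.
  have := cardsUI (pairs X) (pairs Y).
  rewrite pairsI !card_pairs cX cY -/b /w => <-.
  by rewrite exprD mulfK // expf_neq0 // gt_eqF.
apply: le_trans (_ : lam * \sum_(Y in F) \sum_(K in powerset X | (1 < #|K|)%N)
                        w #|K| * (K \subset Y)%:R <= _).
  by rewrite ler_wpM2l ?(ltW lam_gt0) //; apply: ler_sum.
rewrite exchange_big big_distrr /=.
have two_gt0 : 0 < 2 ^+ s :> R by rewrite exprn_gt0.
apply: le_trans (_ : \sum_(K in powerset X | (1 < #|K|)%N)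
                       'C(m, s)%:R * p ^+ (b + b) / 2 ^+ s <= _).
  apply: ler_sum => K /andP[]; rewrite powersetE => KX k2.
  have ks : (#|K| <= s)%N by rewrite -cX subset_leq_card.
  have count : \sum_(Y in F) w #|K| * (K \subset Y)%:R <=
      w #|K| * 'C(m - #|K|, s - #|K|)%:R.
    rewrite -big_distrr ler_wpM2l //= -natr_sum ler_nat.
    apply: leq_trans (card_supersets s (subset_trans KX XU)).
    rewrite -sum1_card big_mkcond [X in (_ <= X)%N]big_mkcond leq_sum // => Y _.
    by rewrite !inE; case: (_ && _) => //=; case: (K \subset Y).
  apply: le_trans (ler_wpM2l (ltW lam_gt0) count) _.
  set k := #|K| in k2 ks *.
  have pk_gt0 : 0 < p ^+ 'C(k, 2) by rewrite exprn_gt0.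
  have sk_gt0 : 0 < s%:R ^+ k :> R by rewrite exprn_gt0 ?ltr0n.
  have key : 'C(m - k, s - k)%:R * (2 ^+ s * lam) <= 'C(m, s)%:R * p ^+ 'C(k, 2) :> R.
    rewrite -(ler_pM2r sk_gt0) -mulrA.
    have k2s : (2 <= k <= s)%N by rewrite k2 ks.
    apply: le_trans (ler_wpM2l (ler0n _ _) (dense k k2s)) _.
    rewrite mulrA [leRHS]mulrAC ler_wpM2r ?(ltW pk_gt0) //.
    by rewrite -!natrX -!natrM ler_nat bin_sub_le // ks sm.
  rewrite ler_pdivlMr // -(ler_pM2r pk_gt0).
  have -> : lam * (w k * 'C(m - k, s - k)%:R) * 2 ^+ s * p ^+ 'C(k, 2) =
     p ^+ (b + b) * ('C(m - k, s - k)%:R * (2 ^+ s * lam)).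
    by rewrite /w; field; rewrite gt_eqF.
  by rewrite [leRHS]mulrAC [leRHS]mulrC ler_wpM2l // exprn_ge0 // ltW.
apply: le_trans (_ : \sum_(K in powerset X) 'C(m, s)%:R * p ^+ (b + b) / 2 ^+ s <= _).
  rewrite big_mkcondr ler_sum // => K _; case: ifP => // _.
  by rewrite divr_ge0 ?mulr_ge0 ?exprn_ge0 // ltW.
by rewrite sumr_const card_powerset cX -[leLHS]mulr_natl natrX mulrC divfK // gt_eqF.
Qed.

End CliqueFree.

(** * Union bound and choice of parameters in the random graph *)

Lemma gnp_probE (R : realType) (n : nat) (p : R) (A : pred {set {set 'I_n}}) :
  gnp_prob p A = bexp p (enum (all_edges 'I_n)) (fun G => (A G)%:R).
Proof.
rewrite /gnp_prob bexpE ?enum_uniq // big_mkcondr set_enum.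
by apply: eq_bigr => G _; case: (A G); rewrite ?mulr1 ?mulr0.
Qed.

Lemma gnp_prob_le1 (R : realType) (n : nat) (p : R) (A : pred {set {set 'I_n}}) :
  0 <= p <= 1 -> gnp_prob p A <= 1.
Proof.
move=> p01; rewrite gnp_probE -[leRHS](bexp_cst p (enum (all_edges 'I_n))).
by apply: bexp_le => // G _; rewrite lern1 leq_b1.
Qed.

Lemma exists_clique_free_prob (R : realType) (V : finType) (p lam : R) (s m : nat) :
    0 < p <= 1 -> (2 <= s <= m)%N -> 0 < lam ->
    (forall k, (2 <= k <= s)%N ->
       2 ^+ s * lam * s%:R ^+ k <= m%:R ^+ k * p ^+ 'C(k, 2)) ->
  bexp p (enum (all_edges V))
    (fun G => [exists U : {set V}, (#|U| == m) && clique_free s G U]%:R)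
    <= 'C(#|V|, m)%:R * expR (- (lam / 4)).
Proof.
move=> p01 sm lam_gt0 dense.
have p01' : 0 <= p <= 1 by case/andP: p01 => p0 ->; rewrite ltW.
apply: le_trans (_ : bexp p (enum (all_edges V)) (fun G =>
    \sum_(U : {set V} | #|U| == m) (clique_free s G U)%:R) <= _).
  apply: bexp_le => // G _; rewrite -natr_sum ler_nat.
  case: existsP => //= -[U /andP[cU cfU]].
  by rewrite (bigD1 U) //= cfU.
rewrite bexp_sum -card_draws -sum1_card natr_sum big_distrl /=.
rewrite [leRHS](eq_bigl (fun U : {set V} => #|U| == m)); last first.
  by move=> U; rewrite inE.
apply: ler_sum => U /eqP cU; rewrite mul1r.
by apply: clique_free_prob; rewrite ?cU.
Qed.

(** The square of the right-hand side is the j-th power of [L ^+ 2 * p ^+ j.+1], which is at least 1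
    since [p <= 1] and [j.+1 <= s]. *)
Lemma pow_bin2_ge1 (R : realType) (L p : R) (j s : nat) :
    0 <= L -> 0 <= p <= 1 -> (j.+1 <= s)%N -> 1 <= L ^+ 2 * p ^+ s ->
  1 <= L ^+ j * p ^+ 'C(j.+1, 2).
Proof.
move=> L0 /andP[p0 p1] js Lp.
have Lp' : 1 <= L ^+ 2 * p ^+ j.+1.
  by apply: le_trans Lp _; rewrite ler_wpM2l ?exprn_ge0 // ler_wiXn2l.
have bin2E : ('C(j.+1, 2) * 2 = j.+1 * j)%N.
  by rewrite mulnC -mul_bin_diag bin1.
have : 1 ^+ 2 <= (L ^+ j * p ^+ 'C(j.+1, 2)) ^+ 2.
  rewrite expr1n exprMn -!exprM bin2E (mulnC j) !exprM -exprMn.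
  exact: exprn_ege1.
by rewrite ler_pXn2r // ?nnegrE ?mulr_ge0 ?exprn_ge0.
Qed.

(** Supplies the hypothesis of [clique_free_prob] with [lam = 8 * m * L]. For [L = ln n] this makes
    [expR (- (lam / 4))] equal to [n] to the power [-2m], enough to beat the number of m-sets. *)
Lemma clique_density (R : realType) (L p : R) (m s k : nat) :
    1 <= L -> 0 <= p <= 1 -> 1 <= L ^+ 2 * p ^+ s.-1 ->
    2 ^+ (s + 3) * s%:R ^+ s * L <= m%:R * p -> (2 <= k <= s)%N ->
  2 ^+ s * (8 * m%:R * L) * s%:R ^+ k <= m%:R ^+ k * p ^+ 'C(k, 2).
Proof.
move=> L1 p01 Lp mp; case: k => [|[|j]] //= js.
have s_gt0 : (0 < s)%N by apply: leq_trans js.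
have [p0 p1] := andP p01.
have L0 : 0 <= L by apply: le_trans L1.
have js' : (j.+1 <= s.-1)%N by rewrite -ltnS prednK.
have H := pow_bin2_ge1 L0 p01 js' Lp.
have s1 : 1 <= s%:R :> R by rewrite ler1n.
set c := 2 ^+ (s + 3) * s%:R ^+ s in mp.
have c1 : 1 <= c.
  by rewrite -[1]mul1r ler_pM // ?exprn_ege1 // ler1n.
have c0 : 0 <= c by apply: le_trans c1.
have -> : m%:R ^+ j.+2 * p ^+ 'C(j.+2, 2) =
    m%:R * ((m%:R * p) ^+ j.+1 * p ^+ 'C(j.+1, 2)).
  by rewrite binS bin1 exprD exprS exprMn; ring.
have -> : 2 ^+ s * (8 * m%:R * L) * s%:R ^+ j.+2 =
    m%:R * (2 ^+ (s + 3) * s%:R ^+ j.+2 * L).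
  by rewrite exprD; ring.
rewrite ler_wpM2l ?ler0n //.
apply: le_trans (_ : c * L <= _).
  by rewrite ler_wpM2r // ler_wpM2l ?exprn_ge0 // ler_weXn2l.
(* One factor [c * L] pays for the left side; the other [j] factors, with the power of [p], multiply
   to at least 1. *)
apply: le_trans (_ : (c * L) ^+ j.+1 * p ^+ 'C(j.+1, 2) <= _); last first.
  rewrite ler_wpM2r ?exprn_ge0 //.
  by rewrite lerXn2r // ?nnegrE ?mulr_ge0 ?ler0n // ltW.
have -> : (c * L) ^+ j.+1 * p ^+ 'C(j.+1, 2) =
   c * L * (c ^+ j * (L ^+ j * p ^+ 'C(j.+1, 2))).
  by rewrite exprS exprMn; ring.
by rewrite ler_peMr ?mulr_ge0 // -[1]mul1r ler_pM // exprn_ege1.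
Qed.

(** Clique-freeness passes to subsets, so every clique-free set has fewer than [m] elements, and
    [card_small_sets] bounds their number. *)
Lemma num_orientations_le_of_cliques (n r m : nat) (G : {set {set 'I_n}}) :
    (1 < n)%N -> (2 < r)%N ->
    ~~ [exists U : {set 'I_n}, (#|U| == m) && clique_free r.-1 G U] ->
  (num_orientations r G <= n ^ (m * n))%N.
Proof.
move=> n1 r2 noU; rewrite expnM; apply: leq_trans (num_orientations_le G r2) _.
rewrite leq_exp2r ?(ltnW n1) //; apply: leq_trans (card_small_sets m n1).
apply/subset_leq_card/subsetP => S; rewrite !inE => cfS; rewrite ltnNge.
apply: contra noU => mS.
have : (0 < #|[set U : {set 'I_n} | U \subset S & #|U| == m]|)%N.
  by rewrite cards_draws bin_gt0.
case/card_gt0P => U; rewrite inE => /andP[US cU].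
apply/existsP; exists U; rewrite cU; apply/forallP => X; apply/implyP => /andP[XU cX].
by have /forallP/(_ X) := cfS; rewrite (subset_trans XU US) cX.
Qed.

Lemma gnp_prob_num_orientations (R : realType) (n s : nat) (p : R) :
    let c := 2 ^+ (s + 3) * s%:R ^+ s in
    (2 < s)%N -> 0 < p <= 1 -> 1 <= ln (n%:R : R) ->
    1 <= ln (n%:R : R) ^+ 2 * p ^+ s.-1 ->
  1 - n%:R^-1 <= gnp_prob p (fun G : {set {set 'I_n}} =>
     (num_orientations s.+1 G)%:R <= expR (2 * c * (n%:R * ln n%:R ^+ 2) / p)).
Proof.
move=> c s3 p01; set L := ln n%:R => L1 Lp.
have [p0 p1] := andP p01.
have p01' : 0 <= p <= 1 by rewrite ltW.
have L0 : 0 < L by apply: lt_le_trans L1.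
have n1 : (1 < n)%N.
  by rewrite ltnNge; apply: contraTN L0 => n1; rewrite -leNgt ln_le0 // lern1.
have n0 : 0 < n%:R :> R by rewrite ltr0n ltnW.
have expL k : expR (L *+ k) = n%:R ^+ k.
  by rewrite -[L *+ k]mulr_natl expRM_natl lnK.
have s1 : 1 <= s%:R :> R by rewrite ler1n (leq_trans _ s3).
have sc : s%:R <= c.
  rewrite /c -[leLHS]mul1r ler_pM //; first by rewrite exprn_ege1 // ler1n.
  by rewrite -[leLHS]expr1 ler_weXn2l // (leq_trans _ s3).
have c0 : 0 < c by apply: lt_le_trans sc; rewrite ltr0n (leq_trans _ s3).
have c1 : 1 <= c by apply: le_trans sc.
pose x := c * L / p.
have cx : c <= x.
  rewrite /x ler_pdivlMr // ler_pM // ?(ltW c0) ?(ltW p0) //.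
  exact: le_trans p1 L1.
have x0 : 0 <= x by rewrite (le_trans _ cx) // ltW.
(* The first integer above [x], so that [m * p >= c * L]; since [x >= 1], rounding up costs at most
   a factor 2, the one in the final constant. *)
pose m := (Num.truncn x).+1.
have xm : x < m%:R by rewrite /m truncnS_gt.
have mx : m%:R <= 2 * x.
  have : (Num.truncn x)%:R <= x by rewrite truncn_le.
  by rewrite /m -natr1; lra.
have sm : (2 <= s <= m)%N.
  by rewrite (ltnW s3) /= -(ler_nat R) (le_trans sc) // (le_trans cx) // ltW.
pose bad := fun G : {set {set 'I_n}} =>
  [exists U : {set 'I_n}, (#|U| == m) && clique_free s G U].
have badP : bexp p (enum (all_edges 'I_n)) (fun G => (bad G)%:R) <= n%:R^-1.
  apply: le_trans (exists_clique_free_prob (lam := 8 * m%:R * L) _ _ _ _ _) _ => //.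
  - by rewrite !mulr_gt0 // ltr0n.
  - move=> k k2s; apply: clique_density => //.
    by rewrite -ler_pdivrMr // ltW.
  rewrite card_ord; apply: le_trans (_ : n%:R ^+ m * expR (- (8 * m%:R * L / 4)) <= _).
    by rewrite ler_wpM2r ?expR_ge0 // -natrX ler_nat bin_le_exp.
  (* In exponents: [m * L - 2 * m * L = - (m * L) <= - L]. *)
  rewrite -expL -expRD -(lnK n0) -expRN ler_expR -/L -mulr_natl.
  have : L <= m%:R * L by rewrite ler_peMl ?(ltW L0) // ler1n.
  lra.
rewrite gnp_probE.
apply: le_trans (_ : bexp p (enum (all_edges 'I_n)) (fun G => 1 - (bad G)%:R) <= _).
  by rewrite bexpB bexp_cst lerD2l lerN2.
apply: bexp_le => // G _.
have [badG|noBad] := boolP (bad G).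
  by rewrite subrr ler0n.
rewrite subr0 ler1n lt0b.
have := @num_orientations_le_of_cliques n s.+1 m G n1 (ltnW s3) noBad.
rewrite -(ler_nat R) => /le_trans; apply.
rewrite natrX -expL ler_expR -[L *+ _]mulr_natl natrM.
have -> : 2 * c * (n%:R * L ^+ 2) / p = 2 * x * (n%:R * L).
  by rewrite /x; field; rewrite gt_eqF.
by rewrite -mulrA ler_wpM2r // mulr_ge0 // ltW.
Qed.

(** * Convergence of the probability to 1 *)

Local Open Scope classical_set_scope.

Theorem theorem5p2 (R : realType) (r : nat) (hr : (4 <= r)%N) :
  exists2 C : R, 0 < C &
    forall p : nat -> R,
      (forall n : nat, 0 <= p n <= 1) ->
      (\forall n \near \oo, (ln (n%:R : R)) `^ (- (2 / (r%:R - 2))) < p n) ->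
      (fun n : nat =>
         gnp_prob (p n) (fun G : {set {set 'I_n}} =>
           (num_orientations r G)%:R <= expR (C * (n%:R * ln n%:R ^+ 2) / p n)))
        @ \oo --> (1 : R).
Proof.
(* The clique size forbidden in the generating sets is [s = r - 1]; the constant depends on [s]
   alone. *)
case: r hr => // s; rewrite ltnS => s3; exists (2 * (2 ^+ (s + 3) * s%:R ^+ s)).
  by rewrite !mulr_gt0 ?exprn_gt0 // ltr0n (leq_trans _ s3).
move=> p p01 p_large.
apply: (@squeeze_cvgr _ _ _ _ (fun n => 1 - n%:R^-1) (fun=> 1)); last 2 first.
- rewrite -[X in _ --> X]subr0; apply: cvgB; first exact: cvg_cst.
  by apply/gtr0_cvgV0; [near=> n; rewrite ltr0n; near: n; exact: nbhs_infty_gt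
                       | exact: cvgr_idn].
- exact: cvg_cst.
near=> n; rewrite gnp_prob_le1 // andbT.
have L1 : 1 <= ln (n%:R : R).
  rewrite -[leLHS]expRK ler_ln ?posrE ?expR_gt0 //.
    by near: n; exact: nbhs_infty_ger.
  by rewrite ltr0n; near: n; exact: nbhs_infty_gt.
have L0 : 0 < ln (n%:R : R) by apply: lt_le_trans L1.
have pn : (ln (n%:R : R)) `^ (- (2 / (s.+1%:R - 2))) < p n by near: n.
have pn0 : 0 < p n by apply: le_lt_trans pn; apply: powR_ge0.
apply: gnp_prob_num_orientations => //; first by case/andP: (p01 n) => _ ->; rewrite pn0.
have s1 : s.+1%:R - 2 = s.-1%:R :> R.
  by rewrite -subn1 natrB ?(leq_trans _ s3) // -natr1; ring.
(* Raising the lower bound on [p n] to the power [r - 2 = s.-1] turns it into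
   [ln n ^+ 2 * p n ^+ s.-1 >= 1], the form used by the density estimate. *)
have : ((ln (n%:R : R)) `^ (- (2 / (s.+1%:R - 2)))) ^+ s.-1 <= p n ^+ s.-1.
  by rewrite lerXn2r ?nnegrE ?powR_ge0 // ltW.
rewrite -powR_mulrn ?powR_ge0 // -powRrM s1 mulNr divfK; last first.
  by rewrite pnatr_eq0 -lt0n -subn1 subn_gt0 (leq_trans _ s3).
rewrite powRN powR_mulrn ?(ltW L0) // => le_p.
by rewrite -ler_pdivrMl ?exprn_gt0 // mulr1.
Unshelve. all: by end_near.
Qed.
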